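(* Let $\Phi$ be a generalized Orlicz function and $H_\Phi$ the corresponding Orlicz premium. If $\Phi$ is GA-convex, then $H_\Phi$ is GG-convex. Conversely, if there exists $u<1$ with $\Phi(u)<1$, then $H_\Phi$ is GG-convex only if $\Phi$ is GA-convex.
   Context: Random variables are defined on a nonatomic probability space $(\Omega,\mathcal F,P)$; (in)equalities between them hold $P$-a.s. $L^\infty_+$ is the set of essentially bounded random variables $X\ge0$. A generalized Orlicz function is a function $\Phi\colon[0,+\infty)\to[0,+\infty)$ that is nondecreasing, left-continuous, and satisfies $\Phi(x)\le1$ for $x\le1$ and $\Phi(x)>1$ for $x>1$. The Orlicz premium is $H_\Phi(X)=\inf\{k>0:\mathbb E[\Phi(X/k)]\le1\}$ for $X\in L^\infty_+$. A function $f$ on $[0,+\infty)$ is GA-convex if $f(x^\lambda y^{1-\lambda})\le\lambda f(x)+(1-\lambda)f(y)$ for all $x,y\in[0,+\infty)$, $\lambda\in(0,1)$. A functional $\rho\colon L^\infty_+\to[0,\infty]$ is GG-convex if $\rho(X^\lambda Y^{1-\lambda})\le\rho(X)^\lambda\rho(Y)^{1-\lambda}$ for all $X,Y\in L^\infty_+$, $\lambda\in(0,1)$ (with $0\cdot(+\infty)=+\infty$). *)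

(* Defs.v *)
From HB Require Import structures.
From mathcomp Require Import all_boot all_order all_algebra.
From mathcomp Require Import all_classical all_reals all_analysis.

Set Implicit Arguments.
Unset Strict Implicit.
Unset Printing Implicit Defensive.

Import Order.TTheory GRing.Theory Num.Theory.
Import numFieldNormedType.Exports.

Local Open Scope classical_set_scope.
Local Open Scope ring_scope.

Definition nonatomic (d : measure_display) (R : realType)
    (T : measurableType d) (P : probability T R) : Prop :=
  forall A : set T, measurable A -> (0 < P A)%E ->
    exists B : set T,
      [/\ measurable B, B `<=` A, (0 < P B)%E & (P B < P A)%E].

(* Functions on [0, +oo[ are represented by total functions R -> R; their values
   at negative arguments are never constrained. *)
Definition generalized_orlicz (R : realType) (Phi : R -> R) : Prop :=
  [/\ forall x, 0 <= x -> 0 <= Phi x,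
      forall x y, 0 <= x -> x <= y -> Phi x <= Phi y,
      forall x, 0 < x -> Phi y @[y --> x^'-] --> Phi x,
      forall x, 0 <= x -> x <= 1 -> Phi x <= 1
    & forall x, 1 < x -> 1 < Phi x].

(* [0 `^ r = 0] for [r != 0], so the case of a zero argument is the usual one. *)
Definition GA_convex (R : realType) (f : R -> R) : Prop :=
  forall x y l : R, 0 <= x -> 0 <= y -> 0 < l -> l < 1 ->
    f (x `^ l * y `^ (1 - l)) <= l * f x + (1 - l) * f y.

(* Random variables are not quotiented by a.s. equality: the sign condition is
   a.s., and negative values, being on a null set, do not affect expectations. *)
Definition Linfty_plus (d : measure_display) (R : realType)
    (T : measurableType d) (P : probability T R) (X : T -> R) : Prop :=
  X \in Lfun P +oo%E /\ {ae P, forall w, 0 <= X w}.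

Definition orlicz_premium (d : measure_display) (R : realType)
    (T : measurableType d) (P : probability T R) (Phi : R -> R)
    (X : T -> R) : \bar R :=
  ereal_inf [set k%:E | k in
    [set k : R | 0 < k /\ ('E_P[(fun w => Phi (X w / k))%R] <= 1)%E]].

(* Product on [0, +oo] with the convention [0 * +oo = +oo], unlike [mule]. *)
Definition mule_infty (R : realType) (x y : \bar R) : \bar R :=
  if (x == +oo%E) || (y == +oo%E) then +oo%E else (x * y)%E.

Definition GG_convex (d : measure_display) (R : realType)
    (T : measurableType d) (P : probability T R)
    (rho : (T -> R) -> \bar R) : Prop :=
  forall (X Y : T -> R) (l : R), Linfty_plus P X -> Linfty_plus P Y ->
    0 < l -> l < 1 ->
    (rho (fun w => X w `^ l * Y w `^ (1 - l))%R
       <= mule_infty (poweR (rho X) l) (poweR (rho Y) (1 - l)%R))%E.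

(* Main.v *)
(* If E[Phi(X/a)] <= 1 and E[Phi(Y/b)] <= 1, GA-convexity of Phi bounds
   E[Phi(X^l Y^(1-l) / (a^l b^(1-l)))] by 1; taking infima over a and b gives
   GG-convexity of the premium.

   Conversely, for step functions left-continuity of Phi gives
   H(X) <= 1 <-> E[Phi(X)] <= 1. Take X = (x, y, c) and Y = (y, x, c) on
   (A, B, rest) with P(A) = P(B) = p, where c and p > 0 are such that
   E[Phi(X)] = E[Phi(Y)] = 1: such a choice exists since Phi takes a value
   below 1 and a value above 1, and since a nonatomic probability attains every
   value in [0, 1]. GG-convexity at l = 1/2 then gives
   E[Phi(sqrt(XY))] <= E[Phi(X)], that is,
   Phi(sqrt(xy)) <= (Phi(x) + Phi(y)) / 2. Together with monotonicity, this
   midpoint inequality implies GA-convexity. *)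

Require Import Defs.
From HB Require Import structures.
From mathcomp Require Import all_boot all_order all_algebra.
From mathcomp Require Import all_classical all_reals all_analysis.
From mathcomp Require Import ring lra.
From mathcomp Require Import measurable_realfun ess_sup_inf.

Set Implicit Arguments.
Unset Strict Implicit.
Unset Printing Implicit Defensive.

Import Order.TTheory GRing.Theory Num.Theory.
Import numFieldNormedType.Exports.

Local Open Scope classical_set_scope.
Local Open Scope ring_scope.

(** * Sierpinski's theorem on the values of a nonatomic probability *)

Section sierpinski.
Context (d : measure_display) (R : realType) (T : measurableType d).
Variable P : probability T R.

Let m (A : set T) : R := fine (P A).

Let PE A : measurable A -> P A = (m A)%:E.
Proof. by move=> mA; rewrite /m fineK// fin_num_measure. Qed.

Let m_ge0 A : 0 <= m A. Proof. exact/fine_ge0/measure_ge0. Qed.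

Let m_le A B : measurable A -> measurable B -> A `<=` B -> m A <= m B.
Proof. by move=> mA mB AB; rewrite -lee_fin -!PE// le_measure ?inE. Qed.

Let mU A B : measurable A -> measurable B -> A `&` B = set0 ->
  m (A `|` B) = m A + m B.
Proof.
move=> mA mB AB; apply/EFin_inj; rewrite EFinD -!PE//; last exact: measurableU.
exact: measureU.
Qed.

Let mD A B : measurable A -> measurable B -> B `<=` A ->
  m (A `\` B) = m A - m B.
Proof.
move=> mA mB BA; have := mU mB (measurableD mA mB) (setDIK _ _).
by rewrite setDUK// => ->; rewrite addrC addKr.
Qed.

(** Nonatomicity splits a set into two parts of positive measure, one of which has at most half of
    the measure. Iterating this halving brings the measure below [e]. *)
Lemma nonatomic_small (A : set T) (e : R) : nonatomic P ->
  measurable A -> 0 < fine (P A) -> 0 < e ->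
  exists B, [/\ measurable B, B `<=` A, 0 < fine (P B) & fine (P B) < e].
Proof.
rewrite -!/(m _) => na mA A0 e0.
have half n : exists B, [/\ measurable B, B `<=` A, 0 < m B &
    m B * 2 ^+ n <= m A].
  elim: n => [|n [B [mB BA B0 Bn]]].
    by exists A; split; rewrite ?expr0 ?mulr1.
  have [|C [mC CB]] := na B mB; first by rewrite PE// lte_fin.
  rewrite !PE// !lte_fin => C0 CltB.
  have [Ch|Ch] := leP (m C * 2) (m B).
    exists C; split => //; first exact: subset_trans CB BA.
    by rewrite exprS mulrA (le_trans _ Bn)// ler_wpM2r// exprn_ge0.
  have DE := mD mB mC CB.
  exists (B `\` C); split.
  - exact: measurableD.
  - by move=> x [/BA].
  - by rewrite DE subr_gt0.
  - rewrite exprS mulrA (le_trans _ Bn)// ler_wpM2r ?exprn_ge0//.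
    by rewrite DE; lra.
have [B [mB BA B0 Bn]] := half (Num.bound (m A / e)).
exists B; split=> //; rewrite -/(m B).
have := upper_nthrootP (leqnn (Num.bound (m A / e))).
rewrite ltr_pdivrMr// => lt1.
set q := 2 ^+ _ in Bn lt1 *.
have q0 : 0 < q by rewrite exprn_gt0.
rewrite -(ltr_pM2r q0) [e * q]mulrC.
exact: le_lt_trans Bn lt1.
Qed.

(* A greedy increasing sequence gains at each step at least half of what can be
   gained, so a deficit in the limit would leave room for infinitely many gains
   bounded below. *)
Lemma nonatomic_measure_value (A : set T) (t : R) : nonatomic P ->
  measurable A -> 0 <= t -> t <= fine (P A) ->
  exists B, [/\ measurable B, B `<=` A & P B = t%:E].
Proof.
rewrite -/(m _) => na mA t0 tA.
pose ok C := [/\ measurable C, C `<=` A & m C <= t].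
have greedy C : ok C -> exists D, [/\ ok D, C `<=` D &
    forall E, ok E -> C `<=` E -> m E - m C <= 2 * (m D - m C)].
  move=> okC; have [mC CA Ct] := okC.
  pose S := [set m E | E in [set E | ok E /\ C `<=` E]].
  have SC : S (m C) by exists C => //; split.
  have supS : has_sup S.
    by split; [exists (m C)|exists t => _ [E [[_ _ Et] _] <-]].
  (* If nothing can be gained, [C] itself serves; otherwise [D] comes within half of the possible
     gain of the supremum. *)
  have [CS|SltC] := ltP (m C) (sup S); last first.
    exists C; split=> // E okE CE; rewrite subrr mulr0 subr_le0.
    by rewrite (le_trans _ SltC)// ub_le_sup//; [exact: supS.2|exists E].
  have [|_ [D [okD CD] <-] DS] := @sup_adherent _ S ((sup S - m C) / 2) _ supS.
    by lra.
  exists D; split=> // E okE CE.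
  have : m E <= sup S by apply: ub_le_sup; [exact: supS.2|exists E].
  by lra.
have /choice[f fP] : forall C, exists D, ok C -> [/\ ok D, C `<=` D &
    forall E, ok E -> C `<=` E -> m E - m C <= 2 * (m D - m C)].
  move=> C; have [/greedy[D DP]|] := pselect (ok C); first by exists D.
  by exists C.
pose C n := iter n f set0.
have okC n : ok (C n).
  elim: n => [|n /fP[]//].
  split; rewrite /C/=; [exact: measurable0|exact: sub0set|].
  by rewrite /m measure0.
have mC n : measurable (C n) by have [] := okC n.
have C_homo : {homo C : n k / (n <= k)%N >-> (n <= k)%O}.
  apply: homo_leq => [B|B D E|n]; [exact: lexx|exact: le_trans|].
  by apply/subsetPset; have [] := fP _ (okC n).
pose U := \bigcup_n C n.
have mU' : measurable U by exact: bigcupT_measurable.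
have CU n : C n `<=` U by move=> x ?; exists n.
have cvgC : (m \o C) n @[n --> \oo] --> m U.
  suff /fine_cvgP[] : (P \o C) n @[n --> \oo] --> (m U)%:E by [].
  by rewrite -PE//; exact: nondecreasing_cvg_mu mC mU' C_homo.
have UA : U `<=` A by move=> x [n _]; have [_ + _] := okC n; apply.
have Ut : m U <= t.
  rewrite -(cvg_lim _ cvgC)//; apply: limr_le.
    by apply/cvg_ex; exists (m U).
  by apply: nearW => n /=; have [] := okC n.
have [Ut'|tU] := ltP (m U) t; last first.
  by exists U; split=> //; rewrite PE//; congr EFin; apply/le_anti/andP.
have mAU : measurable (A `\` U) by exact: measurableD.
(* [B] is small enough for every [C k] to remain admissible when [B] is added to it. *)
have [||B [mB BAU B0 Bt]] := @nonatomic_small (A `\` U) (t - m U) na mAU.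
- by rewrite -/(m _) mD// subr_gt0 (lt_le_trans Ut').
- by rewrite subr_gt0.
rewrite -!/(m _) in B0 Bt.
(* Adding [B] to [C n] gains [m B], so the greedy step gains at least [m B / 2], which pushes
   [m (C n.+1)] above [m U]: a contradiction. *)
have [n /= Cn] : exists n, m U - m B / 2 < m (C n).
  have /cvgr_gt/(_ (m U - m B / 2)) := cvgC.
  case; first by rewrite ltrBlDr ltrDl divr_gt0.
  by move=> n _ /(_ n (leqnn n)); exists n.
have CB k : m (C k `|` B) = m (C k) + m B.
  rewrite mU//; rewrite -subset0 => x [Cx /BAU[_]]; apply.
  exact: CU Cx.
have [_ _ /(_ (C n `|` B))] := fP _ (okC n).
rewrite CB -[f (C n)]/(C n.+1).
have leU k : m (C k) <= m U by apply: m_le.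
have := leU n; have := leU n.+1 => le1 le2 H.
have : m (C n) + m B - m (C n) <= 2 * (m (C n.+1) - m (C n)).
  apply: H; last by move=> x; left.
  split; [exact: measurableU| |by rewrite CB; lra].
  by move=> x [/(CU n)/UA//|/BAU[]].
by lra.
Qed.

End sierpinski.

(** * Comparison of integrals without measurability *)

Section integral_nomeas.
Import HBNNSimple.

(* The library versions require [f] and [g] to be measurable, but [Phi \o X] need
   not be: [Phi] is arbitrary on the negative values of [X]. *)
Lemma ae_ge0_le_integral_nomeas (d : measure_display) (T : measurableType d)
    (R : realType) (mu : {measure set T -> \bar R}) (f g : T -> \bar R) :
  (forall x, 0 <= f x)%E -> (forall x, 0 <= g x)%E ->
  {ae mu, forall x, (f x <= g x)%E} ->
  (\int[mu]_x f x <= \int[mu]_x g x)%E.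
Proof.
move=> f0 g0 [N [mN N0 fgN]].
rewrite (ge0_integralTE _ f0) (ge0_integralTE _ g0).
apply: ge_ereal_sup => _ [/= h hf <-].
have mNC : measurable (~` N) by exact: measurableC.
(* Setting [h] to zero on the null set [N] keeps its integral and puts it below [g] everywhere. *)
pose h' := mul_nnsfun h (indic_nnsfun R mNC).
have h'E x : h' x = h x * \1_(~` N) x by [].
have -> : sintegral mu h = sintegral mu h'.
  rewrite -!integralT_nnsfun; apply: ge0_ae_eq_integral => //.
  - by apply/measurable_EFinP; exact: measurable_funPT.
  - by apply/measurable_EFinP; exact: (measurable_funPT h').
  - by move=> x _; rewrite lee_fin fun_ge0.
  - by move=> x _; rewrite lee_fin (@fun_ge0 _ _ h').
  - exists N; split=> // x hx; apply: contrapT => Nx; apply: hx => _.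
    by rewrite h'E indicE mem_set ?mulr1.
apply: ereal_sup_ubound; exists h' => // x; rewrite h'E indicE.
have [xN|xN] := boolP (x \in ~` N); last by rewrite mulr0.
rewrite mulr1 (le_trans (hf x))//; apply: contrapT => /fgN.
by move/set_mem : xN.
Qed.

End integral_nomeas.

Lemma ae_eq_integral_nomeas (d : measure_display) (T : measurableType d)
    (R : realType) (mu : {measure set T -> \bar R}) (f g : T -> \bar R) :
  {ae mu, forall x, f x = g x} ->
  (\int[mu]_x f x = \int[mu]_x g x)%E.
Proof.
move=> fg; rewrite integralE [RHS]integralE.
have eq_ge0 (u v : T -> \bar R) : (forall x, 0 <= u x)%E ->
    (forall x, 0 <= v x)%E -> {ae mu, forall x, u x = v x} ->
    (\int[mu]_x u x = \int[mu]_x v x)%E.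
  move=> u0 v0 uv; apply/eqP; rewrite eq_le.
  by rewrite !ae_ge0_le_integral_nomeas//; apply: filterS uv => x ->.
by congr (_ - _)%E; apply: eq_ge0 => //; apply: filterS fg => x fgx;
  rewrite !unlock fgx.
Qed.

(** * From the midpoint inequality to GA-convexity *)

(* The defect [h l] of convexity satisfies [h l <= h l' / 2] for [l' = 2 * l] or
   [l' = 2 * l - 1], so its supremum, finite by monotonicity, is nonpositive. *)
Lemma GA_convex_midpoint (R : realType) (f : R -> R) :
  (forall x, 0 <= x -> 0 <= f x) ->
  (forall x y, 0 <= x -> x <= y -> f x <= f y) ->
  (forall x y, 0 <= x -> 0 <= y ->
    f (x `^ 2^-1 * y `^ 2^-1) <= (f x + f y) / 2) ->
  GA_convex f.
Proof.
move=> f0 f_nd mid x y l x0 y0 l0 l1.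
pose g t := x `^ t * y `^ (1 - t).
have g0 t : 0 <= g t by rewrite mulr_ge0// powR_ge0.
(* The 1 in the maximum makes [M] bound all powers of [x] and [y] with exponent in [0, 1]. *)
pose M := Num.max (Num.max 1 x) (Num.max 1 y).
have M1 : 1 <= M by rewrite !le_max lexx.
have M0 : 0 <= M by rewrite (le_trans ler01).
have powM z t : 0 <= z -> z <= M -> 0 <= t -> t <= 1 -> z `^ t <= M.
  move=> z0 zM t0 t1; apply: (@le_trans _ _ (M `^ t)).
    by apply: ge0_ler_powR.
  by rewrite -[leRHS](powRr1 M0) ler_powR.
have gM t : 0 <= t -> t <= 1 -> f (g t) <= f (M * M).
  move=> t0 t1; apply: f_nd => //.
  by apply: ler_pM; rewrite ?powR_ge0 ?powM// ?le_max ?lexx ?orbT//; lra.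
(* [g t] is the geometric mean of [g (2 * t)] and [y], or of [x] and [g (2 * t - 1)]. Adding
   exponents at a possibly zero base is sound because their sum is nonzero. *)
have gl t : 0 < t -> t <= 2^-1 -> g t = g (2 * t) `^ 2^-1 * y `^ 2^-1.
  move=> t0 t1; rewrite /g powRM ?powR_ge0// -!powRrM -mulrA.
  rewrite (_ : 2 * t * 2^-1 = t); last by field.
  rewrite -powRD; last by apply/implyP; rewrite gt_eqF//; lra.
  by congr (_ * _ `^ _); field.
have gr t : 2^-1 <= t -> t < 1 -> g t = x `^ 2^-1 * g (2 * t - 1) `^ 2^-1.
  move=> t0 t1; rewrite /g powRM ?powR_ge0// -!powRrM mulrA.
  rewrite -powRD; last by apply/implyP; rewrite gt_eqF//; lra.
  by congr (_ `^ _ * _ `^ _); field.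
have bnd n t : 0 <= t -> t <= 1 ->
    f (g t) - (t * f x + (1 - t) * f y) <= f (M * M) / 2 ^+ n.
  elim: n t => [|n IHn] t t0 t1.
    rewrite expr0 divr1 lerBlDr ler_wpDr ?gM//.
    by rewrite addr_ge0// mulr_ge0 ?f0// subr_ge0.
  have B0 : 0 <= f (M * M) / 2 ^+ n.+1.
    by rewrite divr_ge0 ?exprn_ge0// f0// mulr_ge0.
  have -> : f (M * M) / 2 ^+ n.+1 = f (M * M) / 2 ^+ n / 2.
    by rewrite exprS invfM mulrA [RHS]mulrAC.
  (* At the endpoints the defect is zero. *)
  move: t0; rewrite le_eqVlt => /predU1P[<-|t0].
    rewrite /g powRr0 mul1r subr0 powRr1// mul0r add0r mul1r subrr.
    by rewrite divr_ge0// divr_ge0 ?exprn_ge0// f0// mulr_ge0.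
  move: t1; rewrite le_eqVlt => /predU1P[->|t1].
    rewrite /g powRr1// subrr powRr0 mulr1 mul0r addr0 mul1r subrr.
    by rewrite divr_ge0// divr_ge0 ?exprn_ge0// f0// mulr_ge0.
  have [th|th] := leP t 2^-1.
    have := IHn (2 * t); have := mid (g (2 * t)) y (g0 _) y0.
    by rewrite -gl// => ? /(_ _ _); lra.
  have := IHn (2 * t - 1); have := mid x (g (2 * t - 1)) x0 (g0 _).
  by rewrite -gr ?(ltW th)// => ? /(_ _ _); lra.
rewrite -/(g l) -subr_le0; apply/ler_addgt0Pr => e e0; rewrite add0r.
apply: le_trans (bnd (Num.bound (f (M * M) / e)) l (ltW l0) (ltW l1)) _.
have := upper_nthrootP (leqnn (Num.bound (f (M * M) / e))).
rewrite ltr_pdivrMr// => /ltW.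
by rewrite ler_pdivrMr ?exprn_gt0// [leRHS]mulrC.
Qed.

(** * Step functions with three values *)

Section steps.
Context (d : measure_display) (R : realType) (T : measurableType d).
Variables (P : probability T R) (A B : set T) (p : R).
Hypotheses (mA : measurable A) (mB : measurable B) (AB : A `&` B = set0).
Hypotheses (PA : P A = p%:E) (PB : P B = p%:E).

Definition step (a b c : R) (w : T) : R :=
  if w \in A then a else if w \in B then b else c.

Lemma step_comp (f : R -> R) a b c w :
  f (step a b c w) = step (f a) (f b) (f c) w.
Proof. by rewrite /step; case: ifP => // _; case: ifP. Qed.

(** The conditional form commutes with functions; this one serves measurability and integration. *)
Lemma stepE a b c w :
  step a b c w = a * \1_A w + b * \1_B w + c * \1_(~` (A `|` B)) w.
Proof.
rewrite /step !indicE in_setC in_setU.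
have [wA|wA] /= := boolP (w \in A).
  have /negbTE-> : w \notin B.
    apply/negP => wB; have : (A `&` B) w by split; apply/set_mem.
    by rewrite AB.
  by rewrite mulr1 !mulr0 !addr0.
by case: ifP => wB /=; rewrite ?(mulr0, mulr1, addr0, add0r).
Qed.

Lemma measurable_step a b c : measurable_fun setT (step a b c).
Proof.
have /funext-> := stepE a b c.
have mC : measurable (~` (A `|` B)) by apply: measurableC; exact: measurableU.
have mi D r : measurable D -> measurable_fun setT (fun w : T => r * \1_D w : R).
  by move=> mD; apply: measurable_funM => //; exact: measurable_indic.
by apply: measurable_funD; [apply: measurable_funD|]; exact: mi.
Qed.

Lemma step_ge0 a b c w : 0 <= a -> 0 <= b -> 0 <= c -> 0 <= step a b c w.
Proof. by rewrite /step; case: ifP => // _; case: ifP. Qed.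

Lemma integral_step a b c : 0 <= a -> 0 <= b -> 0 <= c ->
  (\int[P]_w (step a b c w)%:E = (p * (a + b) + (1 - 2 * p) * c)%:E)%E.
Proof.
move=> a0 b0 c0.
have mU : measurable (A `|` B) by exact: measurableU.
have mC : measurable (~` (A `|` B)) by exact: measurableC.
under eq_integral => w _ do rewrite stepE !EFinD !EFinM.
have mi (D : set T) : measurable D ->
    measurable_fun setT (fun w => (\1_D w : R)%:E).
  by move=> mD; apply/measurable_EFinP; exact: measurable_indic.
have mZ (D : set T) (r : R) : measurable D ->
    measurable_fun setT (fun w => r%:E * (\1_D w : R)%:E)%E.
  by move=> mD; apply: measurable_funeM; exact: mi.
have Z0 (D : set T) (r : R) (w : T) : 0 <= r -> (0 <= r%:E * (\1_D w : R)%:E)%E.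
  by move=> r0; rewrite mule_ge0// lee_fin.
have iZ (D : set T) (r : R) : measurable D -> 0 <= r ->
    (\int[P]_w (r%:E * (\1_D w : R)%:E) = r%:E * P D)%E.
  move=> mD r0; rewrite ge0_integralZl_EFin//; last exact: mi.
  by rewrite integral_indic// setIT.
rewrite ge0_integralD//; last 4 first.
- by move=> w _; rewrite adde_ge0// Z0.
- by apply: emeasurable_funD; exact: mZ.
- by move=> w _; exact: Z0.
- exact: mZ.
rewrite ge0_integralD//; last 4 first.
- by move=> w _; exact: Z0.
- exact: mZ.
- by move=> w _; exact: Z0.
- exact: mZ.
rewrite !iZ// probability_setC//.
have -> : (P (A `|` B) = P A + P B)%E by exact: measureU.
by rewrite PA PB -EFinD; congr EFin; ring.
Qed.

Lemma Linfty_plus_step a b c : 0 <= a -> 0 <= b -> 0 <= c ->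
  Linfty_plus P (step a b c).
Proof.
move=> a0 b0 c0; split; last by apply: nearW => w; exact: step_ge0.
apply/andP; split; rewrite inE/=; first exact: measurable_step.
rewrite /finite_norm Lnorm.unlock; case: ifPn => _; last by rewrite ltry.
apply: le_lt_trans (ltry (a + b + c)); apply/ess_supP; apply: nearW => w /=.
rewrite lee_fin ger0_norm ?step_ge0// /step.
by case: ifP => _; [|case: ifP => _]; lra.
Qed.
End steps.

(** * Basic properties of the Orlicz premium *)

Section orlicz.
Context (d : measure_display) (R : realType) (T : measurableType d).
Variables (P : probability T R) (Phi : R -> R).
Hypothesis Phi_orlicz : generalized_orlicz Phi.

Let Phi_ge0 x : 0 <= x -> 0 <= Phi x.
Proof. by case: Phi_orlicz => + _ _ _ _; apply. Qed.

Let Phi_nd x y : 0 <= x -> x <= y -> Phi x <= Phi y.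
Proof. by case: Phi_orlicz => _ + _ _ _; apply. Qed.

Let Phi_le1 x : 0 <= x -> x <= 1 -> Phi x <= 1.
Proof. by case: Phi_orlicz => _ _ _ + _; apply. Qed.

Let max0_ge0 (x : R) : 0 <= Num.max 0 x. Proof. by rewrite le_max lexx. Qed.

(** Truncation at 0 makes the function nondecreasing on the whole line, whatever [Phi] does at
    negative arguments. *)
Lemma measurable_orlicz_max :
  measurable_fun setT (fun x : R => Phi (Num.max 0 x)).
Proof.
apply: nondecreasing_measurable => // x y xy; apply: Phi_nd => //.
by rewrite ge_max le_max lexx/= le_max xy orbT.
Qed.

Lemma expectation_orlicz_max (X : T -> R) (k : R) :
  {ae P, forall w, 0 <= X w} -> 0 < k ->
  ('E_P[(fun w => Phi (X w / k)%R)] =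
    \int[P]_w (Phi (Num.max 0 (X w / k))%R)%:E)%E.
Proof.
move=> X0 k0; rewrite unlock; apply: ae_eq_integral_nomeas.
apply: filterS X0 => w Xw; congr (Phi _)%:E.
by apply/esym/max_idPr; rewrite divr_ge0// ltW.
Qed.

Lemma orlicz_premium_ge0 (X : T -> R) : (0 <= orlicz_premium P Phi X)%E.
Proof.
by apply: le_ereal_inf_tmp => _ [k [k0 _] <-]; rewrite lee_fin ltW.
Qed.

Lemma orlicz_premium_le (X : T -> R) (k : R) : 0 < k ->
  ('E_P[(fun w => Phi (X w / k)%R)] <= 1)%E ->
  (orlicz_premium P Phi X <= k%:E)%E.
Proof. by move=> k0 Ek; apply: ereal_inf_lbound; exists k. Qed.

(** Dividing [X] by an essential upper bound brings it a.s. into [0, 1], where [Phi] is at most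
    1. *)
Lemma orlicz_premium_lty (X : T -> R) : Linfty_plus P X ->
  (orlicz_premium P Phi X < +oo)%E.
Proof.
move=> [/andP[]]; rewrite !inE/= => mX.
have PT : (0 < P setT)%E by rewrite probability_setT.
rewrite /finite_norm Lnorm.unlock ifT; [move=> Xb X0|exact: PT].
have [M MX] : exists M, {ae P, forall w, X w <= M}.
  have [M MX] := ess_supr_bounded Xb.
  by exists M; apply: filterS MX => w; apply: le_trans; exact: ler_norm.
pose k := Num.max 1 M.
have k0 : 0 < k by rewrite lt_max ltr01.
apply: le_lt_trans (ltry k); apply: orlicz_premium_le => //.
rewrite expectation_orlicz_max//.
apply: (@le_trans _ _ (\int[P]_w (cst 1%E w))%E); last first.
  by rewrite integral_cst// mul1e; exact: probability_le1.
apply: ae_ge0_le_integral_nomeas => //.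
  by move=> w; rewrite lee_fin Phi_ge0.
apply: filterS MX => w Xw; rewrite lee_fin Phi_le1//.
by rewrite ge_max ler01/= ler_pdivrMr// mul1r le_max Xw orbT.
Qed.

(** * GA-convexity of [Phi] implies GG-convexity of the premium *)

Lemma orlicz_premium_GG_level (X Y : T -> R) (l a b : R) : GA_convex Phi ->
  Linfty_plus P X -> Linfty_plus P Y -> 0 < l -> l < 1 -> 0 < a -> 0 < b ->
  ('E_P[(fun w => Phi (X w / a)%R)] <= 1)%E ->
  ('E_P[(fun w => Phi (Y w / b)%R)] <= 1)%E ->
  (orlicz_premium P Phi (fun w => X w `^ l * Y w `^ (1 - l))%R
     <= (a `^ l * b `^ (1 - l))%R%:E)%E.
Proof.
move=> GA [/andP[/[!inE]/= mX _] X0] [/andP[/[!inE]/= mY _] Y0] l0 l1 a0 b0.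
rewrite !expectation_orlicz_max// => EX EY.
have ab0 : 0 < a `^ l * b `^ (1 - l) by rewrite mulr_gt0// powR_gt0.
apply: orlicz_premium_le => //; rewrite unlock.
pose F c (Z : T -> R) w : \bar R := (Phi (Num.max 0 (Z w / c)))%:E.
have F0 c Z w : (0 <= F c Z w)%E by rewrite lee_fin Phi_ge0.
have mF c Z : measurable_fun setT Z -> measurable_fun setT (F c Z).
  move=> mZ; apply/measurable_EFinP.
  apply: (measurableT_comp measurable_orlicz_max).
  exact: measurable_funM.
have l1' : 0 <= 1 - l by rewrite subr_ge0 ltW.
(* The left integrand is not truncated: powers are nonnegative even where [X] or [Y] is negative. *)
apply: (@le_trans _ _ (\int[P]_w (l%:E * F a X w + (1 - l)%:E * F b Y w))%E).
  apply: ae_ge0_le_integral_nomeas => [w|w|].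
  - by rewrite lee_fin Phi_ge0// divr_ge0 ?(ltW ab0)// mulr_ge0// powR_ge0.
  - by rewrite adde_ge0// mule_ge0// lee_fin ltW.
  apply: filterS2 X0 Y0 => w X0 Y0.
  rewrite /F !max_r ?divr_ge0 ?(ltW a0) ?(ltW b0)// -!EFinM -EFinD lee_fin.
  have div_powR x c r : 0 <= x -> 0 < c -> (x / c) `^ r = x `^ r / c `^ r.
    move=> x0 c0; rewrite powRM// ?invr_ge0 ?ltW//; congr (_ * _).
    by rewrite -powRN -powR_inv1 ?ltW// -powRrM mulN1r.
  have -> : X w `^ l * Y w `^ (1 - l) / (a `^ l * b `^ (1 - l)) =
      (X w / a) `^ l * (Y w / b) `^ (1 - l).
    by rewrite !div_powR// invfM mulrACA.
  by apply: GA; rewrite // divr_ge0// ltW.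
rewrite ge0_integralD//; last 4 first.
- by move=> w _; rewrite mule_ge0// lee_fin ltW.
- by apply: measurable_funeM; exact: mF.
- by move=> w _; rewrite mule_ge0// lee_fin.
- by apply: measurable_funeM; exact: mF.
rewrite !ge0_integralZl_EFin ?(ltW l0)//; [|exact: mF|exact: mF].
apply: (@le_trans _ _ (l%:E * 1 + (1 - l)%:E * 1)%E); last first.
  by rewrite !mule1 -EFinD lee_fin addrC subrK.
by apply: leeD; apply: lee_wpmul2l => //; rewrite lee_fin// ltW.
Qed.

Lemma GA_convex_GG_convex : GA_convex Phi -> GG_convex P (orlicz_premium P Phi).
Proof.
move=> GA X Y l LX LY l0 l1.
set Z := fun w => _.
have l1' : 0 < 1 - l by rewrite subr_gt0.
have fin U : Linfty_plus P U -> orlicz_premium P Phi U \is a fin_num.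
  by move=> LU; rewrite ge0_fin_numE ?orlicz_premium_ge0// orlicz_premium_lty.
have HX0 := orlicz_premium_ge0 X; have HY0 := orlicz_premium_ge0 Y.
have HZ0 := orlicz_premium_ge0 Z.
have level a b : 0 < a -> ('E_P[(fun w => Phi (X w / a)%R)] <= 1)%E ->
   0 < b -> ('E_P[(fun w => Phi (Y w / b)%R)] <= 1)%E ->
   (orlicz_premium P Phi Z <= (a `^ l * b `^ (1 - l))%R%:E)%E.
  by move=> *; exact: orlicz_premium_GG_level.
(* [c <= k `^ r * e] is inverted to a lower bound on [k], which passes to the
   infimum defining the premium. *)
have pass (U : T -> R) (r c e : R) :
    Linfty_plus P U -> 0 < r -> 0 <= c -> 0 <= e ->
    (forall k, 0 < k -> ('E_P[(fun w => Phi (U w / k)%R)] <= 1)%E ->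
      c <= k `^ r * e) ->
    c <= fine (orlicz_premium P Phi U) `^ r * e.
  (* For [e = 0] any admissible [k] gives [c <= 0]; one exists because the premium is finite. *)
  move=> LU r0 c0; rewrite le_eqVlt => /predU1P[<-|e0] H.
    have /ereal_inf_lt[_ [k [k0 Ek] <-] _] := orlicz_premium_lty LU.
    by rewrite mulr0 (le_trans (H _ k0 Ek))// mulr0.
  rewrite -ler_pdivrMr//.
  have ce0 : 0 <= c / e by rewrite divr_ge0// ltW.
  have -> : c / e = ((c / e) `^ r^-1) `^ r
    by rewrite -powRrM mulVf ?gt_eqF// powRr1.
  apply: ge0_ler_powR; [exact: ltW|exact: powR_ge0| |].
    by rewrite nnegrE fine_ge0// orlicz_premium_ge0.
  rewrite -lee_fin fineK ?fin//; apply: le_ereal_inf_tmp => _ [k [k0 Ek] <-].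
  rewrite lee_fin -[leRHS](powRr1 (ltW k0)) -(@mulfV _ r) ?gt_eqF// powRrM.
  apply: ge0_ler_powR; [by rewrite invr_ge0 ltW| |exact: powR_ge0|].
    by rewrite nnegrE.
  by rewrite ler_pdivrMr// H.
have finZ : orlicz_premium P Phi Z \is a fin_num.
  rewrite ge0_fin_numE//.
  have /ereal_inf_lt[_ [a [a0 Ea] <-] _] := orlicz_premium_lty LX.
  have /ereal_inf_lt[_ [b [b0 Eb] <-] _] := orlicz_premium_lty LY.
  exact: le_lt_trans (level _ _ a0 Ea b0 Eb) (ltry _).
rewrite -(fineK (fin _ LX)) -(fineK (fin _ LY)) !poweR_EFin /mule_infty/=.
rewrite -EFinM -(fineK finZ) lee_fin.
(* The two infima are handled in turn: first the premium of [X] is replaced by an admissible [a],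
   then that of [Y] by an admissible [b]. *)
apply: (pass); rewrite ?powR_ge0 ?fine_ge0// => a a0 Ea.
rewrite mulrC; apply: (pass); rewrite ?powR_ge0 ?fine_ge0// => b b0 Eb.
by rewrite mulrC -lee_fin fineK// level.
Qed.

(** * The sublevel set of the premium at 1, for step functions *)

Lemma orlicz_left_approx (x e : R) : 0 <= x -> 0 < e ->
  exists2 k0 : R, 1 < k0 &
    forall k, 1 < k -> k <= k0 -> Phi x - e <= Phi (x / k).
Proof.
rewrite le_eqVlt => /predU1P[<- e0|x0 e0].
  by exists 2 => [|k _ _]; rewrite ?ltr1n// mul0r gerBl ltW.
have [_ _ /(_ _ x0) lc _ _] := Phi_orlicz.
have [y [ye y0 yx]] : exists y, [/\ Phi x - e < Phi y, 0 < y & y < x].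
  apply: (@filter_ex _ (x^'-)); near=> y; split.
  - by near: y; apply: (cvgr_gt _ lc); rewrite ltrBlDr ltrDl.
  - by near: y; exact: nbhs_left_gt.
  - by near: y; exact: nbhs_left_lt.
(* For [k <= x / y] the quotient [x / k] is still at least [y]. *)
exists (x / y); first by rewrite ltr_pdivlMr// mul1r.
move=> k k1 kxy; have k0 : 0 < k by rewrite (lt_trans ltr01).
rewrite (le_trans (ltW ye))// Phi_nd ?(ltW y0)//.
by rewrite ler_pdivlMr// mulrC -ler_pdivlMr.
Unshelve. all: by end_near. Qed.

Section level.
Variables (A B : set T) (p : R).
Hypotheses (mA : measurable A) (mB : measurable B) (AB : A `&` B = set0).
Hypotheses (PA : P A = p%:E) (PB : P B = p%:E) (p0 : 0 <= p) (p2 : p <= 2^-1).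

Lemma expectation_step (a b c k : R) : 0 <= a -> 0 <= b -> 0 <= c -> 0 < k ->
  ('E_P[(fun w => Phi (step A B a b c w / k)%R)] =
    (p * (Phi (a / k) + Phi (b / k)) + (1 - 2 * p) * Phi (c / k))%R%:E)%E.
Proof.
move=> a0 b0 c0 k0; rewrite unlock.
under eq_integral => w _ do rewrite (step_comp _ _ (fun t => Phi (t / k))).
by rewrite (integral_step mA mB AB PA PB)// Phi_ge0// divr_ge0// ltW.
Qed.

(** A premium at most 1 yields admissible [k'] below any [k > 1]. With [k] close to 1,
    left-continuity costs at most [e] at each value, hence [e] in all, since the weights [p], [p],
    [1 - 2 * p] sum to 1. *)
Lemma orlicz_premium_step_le1 (a b c : R) : 0 <= a -> 0 <= b -> 0 <= c ->
  (orlicz_premium P Phi (step A B a b c) <= 1)%E <->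
  p * (Phi a + Phi b) + (1 - 2 * p) * Phi c <= 1.
Proof.
move=> a0 b0 c0; split => [H1|H1]; last first.
  by apply: orlicz_premium_le => //; rewrite expectation_step// !divr1 lee_fin.
apply/ler_addgt0Pr => e e0.
have [ka ka1 kaP] := orlicz_left_approx a0 e0.
have [kb kb1 kbP] := orlicz_left_approx b0 e0.
have [kc kc1 kcP] := orlicz_left_approx c0 e0.
pose k := Num.min ka (Num.min kb kc).
have k1 : 1 < k by rewrite !lt_min ka1 kb1.
have {}kaP : Phi a - e <= Phi (a / k) by rewrite kaP// ge_min lexx.
have {}kbP : Phi b - e <= Phi (b / k) by rewrite kbP// !ge_min lexx orbT.
have {}kcP : Phi c - e <= Phi (c / k) by rewrite kcP// !ge_min lexx !orbT.
have /ereal_inf_lt[_ [k' [k'0 +] <-]] :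
    (orlicz_premium P Phi (step A B a b c) < k%:E)%E.
  by rewrite (le_lt_trans H1)// lte_fin.
rewrite expectation_step// lee_fin lte_fin => Ek' k'k.
have mono t : 0 <= t -> Phi (t / k) <= Phi (t / k').
  move=> t0; apply: Phi_nd.
    by rewrite divr_ge0// (le_trans (ltW k'0)) ?ltW.
  by rewrite ler_wpM2l// lef_pV2 ?posrE ?(ltW k'k)// (lt_trans k'0).
have := mono a a0; have := mono b b0; have := mono c c0.
move=> Mc Mb Ma.
have p1 : 0 <= 1 - 2 * p by move: p2; lra.
have : p * ((Phi a - e) + (Phi b - e)) <= p * (Phi (a / k') + Phi (b / k')).
  by rewrite ler_wpM2l//; lra.
have : (1 - 2 * p) * (Phi c - e) <= (1 - 2 * p) * Phi (c / k').
  by rewrite ler_wpM2l//; lra.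
by lra.
Qed.
End level.

(** * GG-convexity of the premium implies the midpoint inequality *)

Lemma GG_convex_midpoint (u : R) :
  nonatomic P -> 0 <= u -> u < 1 -> Phi u < 1 ->
  GG_convex P (orlicz_premium P Phi) ->
  forall x y, 0 <= x -> 0 <= y ->
    Phi (x `^ 2^-1 * y `^ 2^-1) <= (Phi x + Phi y) / 2.
Proof.
move=> na u0 u1 Pu GG x y x0 y0.
(* [c] is below or above 1 according to the sign of [2 - Phi x - Phi y], which
   makes the expectation equal to 1 for some mass [p]. *)
have [c [p [c0 p0 p2 E1]]] : exists c p, [/\ 0 <= c, 0 < p, p <= 2^-1 &
    p * (Phi x + Phi y) + (1 - 2 * p) * Phi c = 1].
  set S := Phi x + Phi y.
  (* [p] solves the linear equation for the given [c]; the bound [p <= 2^-1] amounts to [2 <= S] for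
     [c = u] and to [S <= 2] for [c = 2]. *)
  have [S2|S2] := leP 2 S.
    have D0 : 0 < S - 2 * Phi u by lra.
    exists u, ((1 - Phi u) / (S - 2 * Phi u)); split=> //.
    - by rewrite divr_gt0// subr_gt0.
    - by rewrite ler_pdivrMr//; lra.
    - by field; rewrite gt_eqF.
  have Phi2 : 1 < Phi 2 by case: Phi_orlicz => _ _ _ _; apply; rewrite ltr1n.
  have D0 : 0 < 2 * Phi 2 - S by lra.
  exists 2, ((Phi 2 - 1) / (2 * Phi 2 - S)); split=> //.
  - by rewrite divr_gt0// subr_gt0.
  - by rewrite ler_pdivrMr//; lra.
  - by field; rewrite gt_eqF.
have [C [mC _ PC]] :
    exists C, [/\ measurable C, C `<=` setT & P C = (2 * p)%:E].
  apply: (nonatomic_measure_value na measurableT); first by lra.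
  by rewrite probability_setT/=; lra.
have [A [mA AC PA]] : exists A, [/\ measurable A, A `<=` C & P A = p%:E].
  by apply: (nonatomic_measure_value na mC); rewrite ?PC/=; lra.
pose B := C `\` A.
have mB : measurable B by exact: measurableD.
have AB : A `&` B = set0 by rewrite setDIK.
have PB : P B = p%:E.
  have PCy : (P C < +oo)%E by rewrite PC ltry.
  have -> : (P B = P C - P (C `&` A))%E by exact: measureD.
  by rewrite setIidr// PA PC -EFinB; congr EFin; ring.
have level := @orlicz_premium_step_le1 A B p mA mB AB PA PB (ltW p0) p2.
have h2 : 1 - 2^-1 = 2^-1 :> R by field.
have := GG (step A B x y c) (step A B y x c) 2^-1
  (Linfty_plus_step P mA mB AB x0 y0 c0) (Linfty_plus_step P mA mB AB y0 x0 c0).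
rewrite h2 => /(_ _ _)/le_trans-/(_ 1%E).
set z := x `^ 2^-1 * y `^ 2^-1.
have z0 : 0 <= z by rewrite mulr_ge0// powR_ge0.
(* Swapping [x] and [y] gives the same geometric mean [z] on [A] and [B]; elsewhere the mean of [c]
   with itself is [c]. *)
have -> : (fun w => step A B x y c w `^ 2^-1 * step A B y x c w `^ 2^-1) =
    step A B z z c.
  apply/funext => w; rewrite /step; case: ifP => // _.
  case: ifP => _; first by rewrite mulrC.
  rewrite -powRD; last by apply/implyP; rewrite gt_eqF//; lra.
  by rewrite (_ : 2^-1 + 2^-1 = 1) ?powRr1//; field.
have HX : (orlicz_premium P Phi (step A B x y c) <= 1)%E.
  by apply/level; rewrite ?E1.
have HY : (orlicz_premium P Phi (step A B y x c) <= 1)%E.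
  by apply/level; rewrite // [Phi y + _]addrC E1.
have sq1 (v : \bar R) : (0 <= v -> v <= 1 ->
    [/\ poweR v 2^-1 != +oo, 0 <= poweR v 2^-1 & poweR v 2^-1 <= 1])%E.
  case: v => [r||]//; rewrite !lee_fin => r0 r1; rewrite poweR_EFin; split=> //.
    exact: powR_ge0.
  apply: (@le_trans _ _ (1 `^ 2^-1)); last by rewrite powR1.
  by apply: ge0_ler_powR; rewrite ?nnegrE ?invr_ge0.
have [HX1 HX2 HX3] := sq1 _ (orlicz_premium_ge0 _) HX.
have [HY1 HY2 HY3] := sq1 _ (orlicz_premium_ge0 _) HY.
rewrite /mule_infty (negbTE HX1) (negbTE HY1)/= => HZ.
have /level : (orlicz_premium P Phi (step A B z z c) <= 1)%E.
  apply: HZ; rewrite ?invr_gt0//; first by lra.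
  by rewrite -[leRHS]mule1 lee_pmul.
move=> /(_ z0 z0 c0) Z1.
(* The common term [(1 - 2 * p) * Phi c] cancels between [Z1] and [E1]. *)
have : p * (Phi z + Phi z) <= p * (Phi x + Phi y) by lra.
by rewrite ler_pM2l//; lra.
Qed.

End orlicz.

Theorem proposition22 (d : measure_display) (R : realType)
    (T : measurableType d) (P : probability T R) (Phi : R -> R)
    (P_nonatomic : nonatomic P) (Phi_orlicz : generalized_orlicz Phi) :
  (GA_convex Phi -> GG_convex P (orlicz_premium P Phi)) /\
  ((exists u : R, [/\ 0 <= u, u < 1 & Phi u < 1]) ->
    GG_convex P (orlicz_premium P Phi) -> GA_convex Phi).
Proof.
split; first exact: GA_convex_GG_convex.
move=> [u [u0 u1 Pu]] GG; have [Phi_ge0 Phi_nd _ _ _] := Phi_orlicz.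
apply: GA_convex_midpoint => //.
exact: GG_convex_midpoint Pu GG.
Qed.
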